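(* Let $T\in(0,\infty)$, and let $\mu_T$, $\mu_T^{(N)}$ ($N\in\mathbb{N}$) and $\nu_k^{\Delta t}$ ($k\in\mathbb{N}_0$, $\Delta t\in(0,1)$) be the probability distributions on $H=L^2(0,1)$ defined in the context. Then \[ \limsup_{N\to\infty}\ \sup_{\phi\in\mathcal{C}^0(H,\mathbb{R}),\ \|\phi\|_0\le 1}\Big|\int_H\phi\,d\mu_T-\int_H\phi\,d\mu_T^{(N)}\Big|>0, \] and \[ \limsup_{\Delta t\to 0}\ \sup_{\phi\in\mathcal{C}^0(H,\mathbb{R}),\ \|\phi\|_0\le 1}\Big|\int_H\phi\,d\mu_T-\int_H\phi\,d\nu_{\lfloor T/\Delta t\rfloor}^{\Delta t}\Big|>0. \]
   Context: Let $H=L^2(0,1)$ with inner product $\langle\cdot,\cdot\rangle$ and norm $|\cdot|$. For $n\in\mathbb{N}=\{1,2,\ldots\}$ let $\lambda_n=\pi^2n^2$ and $e_n=\sqrt2\sin(n\pi\,\cdot)$, a complete orthonormal system of $H$. Let $A$ be the self-adjoint operator $Ax=-\sum_{n}\lambda_n\langle x,e_n\rangle e_n$ on $D(A)=\{x\in H:\sum_n\lambda_n^2\langle x,e_n\rangle^2<\infty\}$ (Dirichlet Laplacian), generating the semigroup $e^{tA}x=\sum_n e^{-\lambda_nt}\langle x,e_n\rangle e_n$. Let $(\beta_n)_{n\in\mathbb{N}}$ be independent standard real Wiener processes on a probability space and $W(t)=\sum_n\beta_n(t)e_n$ the cylindrical Wiener process. Let $X(t)=\int_0^te^{(t-s)A}dW(s)=\sum_n\big(\int_0^te^{-\lambda_n(t-s)}d\beta_n(s)\big)e_n$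 be the mild solution of $dX=AX\,dt+dW$, $X(0)=0$, and let $\mu_t$ denote the law of $X(t)$ (a centered Gaussian measure on $H$ with covariance $Q_te_n=\frac{1}{2\lambda_n}(1-e^{-2\lambda_nt})e_n$). Spectral Galerkin discretization: for $N\in\mathbb{N}$, $P_N$ is the orthogonal projection onto $\mathrm{Span}(e_1,\ldots,e_N)$, $X^{(N)}(t)=P_NX(t)$ (the solution of $dX^{(N)}=AX^{(N)}dt+P_NdW$, $X^{(N)}(0)=0$), and $\mu_t^{(N)}$ is the law of $X^{(N)}(t)$. Linear implicit Euler scheme: for $\Delta t\in(0,1)$, let $S_{\Delta t}=(I-\Delta tA)^{-1}$, $X_0^{\Delta t}=0$, $X_{k+1}^{\Delta t}=S_{\Delta t}X_k^{\Delta t}+S_{\Delta t}\big(W((k+1)\Delta t)-W(k\Delta t)\big)$ for $k\in\mathbb{N}_0$ (so $X_k^{\Delta t}=\sum_{\ell=0}^{k-1}S_{\Delta t}^{k-\ell}(W((\ell+1)\Delta t)-W(\ell\Delta t))$), and $\nu_k^{\Delta t}$ is the law of $X_k^{\Delta t}$ (centered Gaussian with covariance $\Delta t\sum_{\ell=0}^{k-1}S_{\Delta t}^{2(k-\ell)}$). $\mathcal{C}^0(H,\mathbb{R})$ denotes the bounded continuous functions $H\to\mathbb{R}$, with $\|\phi\|_0=\sup_{x\in H}|\phi(x)|$. *)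

(* Defs.v *)
From HB Require Import structures.
From mathcomp Require Import all_boot all_order all_algebra.
From mathcomp Require Import all_classical all_reals all_analysis.
Set Implicit Arguments. Unset Strict Implicit. Unset Printing Implicit Defensive.
Import Order.TTheory GRing.Theory Num.Def Num.Theory.
Import numFieldNormedType.Exports.
Local Open Scope classical_set_scope.
Local Open Scope ring_scope.

(* H = L^2(0,1) is identified with l^2 through the orthonormal basis
   e_{n+1} = sqrt 2 sin((n+1) pi .), n : nat (0-indexed): a point x of H is
   the coordinate sequence (n |-> <x, e_{n+1}>). *)
Section Defs.
Variable R : realType.

(* eigenvalues lambda_{n+1} = pi^2 (n+1)^2 *)
Definition lam (n : nat) : R := pi ^+ 2 * (n.+1%:R) ^+ 2.

Definition l2 (x : nat -> R) : Prop :=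
  cvgn (series (fun n => x n ^+ 2)).

Definition l2norm (x : nat -> R) : R :=
  Num.sqrt (limn (series (fun n => x n ^+ 2))).

Definition Cb1 : set ((nat -> R) -> R) :=
  [set phi | (forall x, l2 x -> forall e : R, 0 < e ->
                 exists2 d : R, 0 < d & forall y, l2 y ->
                   l2norm (fun n => x n - y n) < d -> `|phi x - phi y| < e)
             /\ (forall x, l2 x -> `|phi x| <= 1)].

Definition mutually_independent d (O : measurableType d) (P : probability O R)
  (xi : nat -> O -> R) : Prop :=
  forall (s : seq nat) (A : nat -> set R), uniq s ->
    (forall i, measurable (A i)) ->
    P [set w | forall i, i \in s -> A i (xi i w)] =
    (\big[*%E/1%E]_(i <- s) P (xi i @^-1` A i))%E.

Definition iid_std_normal d (O : measurableType d) (P : probability O R)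
  (xi : nat -> O -> R) : Prop :=
  (forall n, measurable_fun setT (xi n)) /\
  (forall n (A : set R), measurable A ->
     P (xi n @^-1` A) = normal_prob 0 1 A) /\
  mutually_independent P xi.

(* Centered Gaussian H-valued random variable with diagonal covariance
   Q e_n = c n e_n, in coordinates sqrt(c n) xi_n; on the (null, when
   sum c < oo) event where the series is not in l^2 we set it to 0. *)
Definition gauss_diag d (O : measurableType d) (xi : nat -> O -> R)
  (c : nat -> R) (w : O) : nat -> R :=
  let x := fun n => Num.sqrt (c n) * xi n w in
  if `[< l2 x >] then x else (fun _ => 0).

Definition cov_exact (t : R) (n : nat) : R :=
  (1 - expR (- (2 * lam n * t))) / (2 * lam n).

(* covariance of mu_t^(N): P_N Q_t P_N *)
Definition cov_galerkin (N : nat) (t : R) (n : nat) : R :=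
  if (n < N)%N then cov_exact t n else 0.

Definition cov_euler (dt : R) (k : nat) (n : nat) : R :=
  dt * \sum_(0 <= l < k) (1 + dt * lam n) ^- (2 * (k - l)).

Definition gint d (O : measurableType d) (P : probability O R)
  (xi : nat -> O -> R) (c : nat -> R) (phi : (nat -> R) -> R) : \bar R :=
  (\int[P]_w (phi (gauss_diag xi c w))%:E)%E.

Definition dist_Cb d (O : measurableType d) (P : probability O R)
  (xi : nat -> O -> R) (c1 c2 : nat -> R) : \bar R :=
  ereal_sup [set `|(gint P xi c1 phi - gint P xi c2 phi)%E|%E | phi in Cb1].

End Defs.

(* Main.v *)
(* All the laws are images of the same i.i.d. sequence, so one coordinate separates
   them.  Along e_n the exact law is N(0, c1), the discrete law N(0, c2), with
   c2 / c1 = 0 for the Galerkin law as soon as n >= N (the (N+1)-st coordinate), and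
   c2 / c1 <= C / (dt lam_n) for the Euler law, which is arbitrarily small for large
   n at fixed dt.  The test function min(1, |x_n| / sqrt c1) then has expectation at
   least P(|xi_n| >= 1) under the exact law and at most
   sqrt (c2 / c1) E(1 + xi_n^2) under the discrete one, a gap that does not depend
   on N or dt. *)
Require Import Defs.
From HB Require Import structures.
From mathcomp Require Import all_boot all_order all_algebra.
From mathcomp Require Import all_classical all_reals all_analysis.
From mathcomp Require Import measurable_realfun ring lra.
Import Order.TTheory GRing.Theory Num.Def Num.Theory.
Import numFieldNormedType.Exports.
Local Open Scope classical_set_scope.
Local Open Scope ring_scope.

(** * Integrals and probabilities under N(0, 1) *)

Section normal.
Context {R : realType}.
Local Notation mu := (@lebesgue_measure R).

(** Change of variables by the Radon-Nikodym derivative, which agrees almost everywhere with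
    [normal_pdf] because both have the same integral over every measurable set. *)
Lemma ge0_integral_normal_prob (m s : R) (f : measurableTypeR R -> \bar R) :
  measurable_fun [set: measurableTypeR R] f -> (forall x, 0 <= f x)%E ->
  (\int[normal_prob m s]_x f x = \int[mu]_x (f x * (normal_pdf m s x)%:E))%E.
Proof.
move=> mf f0; have dom := normal_prob_dominates m s.
rewrite -(Radon_Nikodym_SigmaFinite.change_of_variables dom)//.
have iRN := Radon_Nikodym_SigmaFinite.f_integrable dom.
have mpdf : measurable_fun setT (fun x => (normal_pdf m s x)%:E).
  by apply/measurable_EFinP; exact: measurable_normal_pdf.
apply: ae_eq_integral => //.
- by apply: emeasurable_funM => //; exact: measurable_int iRN.
- exact: emeasurable_funM.
- apply: ae_eqe_mul2l; apply: integral_ae_eq => //.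
  by move=> E _ mE; rewrite -Radon_Nikodym_SigmaFinite.f_integral.
Qed.

(* [x ^ 2 <= 4 exp (x ^ 2 / 4)] bounds the second moment of N(0, 1) by a multiple
   of the total mass of N(0, 2). *)
Lemma normal_prob_sqr_lty :
  (\int[normal_prob (0 : R) 1]_x (x ^+ 2)%:E < +oo)%E.
Proof.
have msq : measurable_fun setT (fun x : R => (x ^+ 2)%:E).
  by apply/measurable_EFinP; exact: measurable_funX.
rewrite ge0_integral_normal_prob//; last by move=> x; rewrite lee_fin sqr_ge0.
have s20 : Num.sqrt 2 != 0 :> R by rewrite gt_eqF// sqrtr_gt0.
(* The ratio of peaks exchanges the normalising constant of N(0, 1) for that of N(0, 2), whose
   standard deviation is [Num.sqrt 2]. *)
pose C : R := 4 * normal_peak 1 / normal_peak (Num.sqrt 2).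
have pk2 : 0 < normal_peak (Num.sqrt 2 : R) by exact: normal_peak_gt0.
have C0 : 0 <= C by rewrite /C !mulr_ge0 ?invr_ge0 ?normal_peak_ge0.
have mpdf s : measurable_fun setT (fun x : R => (normal_pdf 0 s x)%:E).
  by apply/measurable_EFinP; exact: measurable_normal_pdf.
apply: (@le_lt_trans _ _ (\int[mu]_x (C%:E * (normal_pdf 0 (Num.sqrt 2) x)%:E))%E).
  apply: ge0_le_integral => //.
  - by move=> x _; rewrite mule_ge0// lee_fin ?sqr_ge0 ?normal_pdf_ge0.
  - exact: emeasurable_funM msq (mpdf 1).
  - exact: emeasurable_funM (measurable_cst _) (mpdf _).
  - move=> x _; rewrite -!EFinM lee_fin !normal_pdfE ?oner_neq0//.
    rewrite /C [leRHS](_ : _ =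
      normal_peak 1 * (4 * normal_fun 0 (Num.sqrt 2) x)); last first.
      by rewrite /normal_fun; field; rewrite gt_eqF.
    rewrite [leLHS]mulrCA; apply: ler_wpM2l; first exact: normal_peak_ge0.
    rewrite /normal_fun sqr_sqrtr// subr0 expr1n.
    rewrite (_ : - x ^+ 2 / (1 *+ 2) = - x ^+ 2 / 4 + - x ^+ 2 / (2 *+ 2)); last by field.
    rewrite expRD mulrA; apply: ler_wpM2r; first exact: expR_ge0.
    rewrite mulNr expRN ler_pdivrMr ?expR_gt0//.
    have := expR_ge1Dx (x ^+ 2 / 4); lra.
rewrite ge0_integralZl//=; first last.
- by move=> x _; rewrite lee_fin normal_pdf_ge0.
- exact: mpdf.
by rewrite integral_normal_pdf mule1 ltry.
Qed.

(** On [1, 2] the density is at least its peak times exp(-2). This probability is the source of the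
    uniform gap. *)
Lemma normal_prob_norm_ge1_gt0 :
  (0 < normal_prob (0 : R) 1 [set x : R | (1 <= `|x|)%R])%E.
Proof.
have mA : measurable [set x : R | 1 <= `|x|].
  rewrite -[X in measurable X]setTI.
  by apply: measurable_fun_le => //; exact: measurableT_comp.
pose e : R := normal_peak 1 * expR (- 2).
have e0 : 0 < e by rewrite mulr_gt0 ?normal_peak_gt0 ?expR_gt0 ?oner_neq0.
apply: (@lt_le_trans _ _ (\int[mu]_(x in `[1%R, 2%R]) (cst e%:E) x)%E).
  rewrite integral_cst//= lebesgue_measure_itv/= lte_fin ltr1n.
  by rewrite -EFinB -EFinM lte_fin mulr_gt0//; lra.
apply: (@le_trans _ _ (\int[mu]_(x in `[1%R, 2%R]) (normal_pdf 0 1 x)%:E)%E).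
  apply: ge0_le_integral => //.
  - by move=> x _; rewrite lee_fin ltW.
  - by apply/measurable_EFinP/measurable_funTS; exact: measurable_normal_pdf.
  - move=> x /=; rewrite in_itv/= => /andP[x1 x2].
    rewrite lee_fin normal_pdfE ?oner_neq0//.
    apply: ler_wpM2l; first exact: normal_peak_ge0.
    rewrite /normal_fun ler_expR subr0 expr1n.
    have : x ^+ 2 <= 4 by nra.
    lra.
apply: ge0_subset_integral => //.
- by apply/measurable_EFinP/measurable_funTS; exact: measurable_normal_pdf.
- by move=> x _; rewrite lee_fin normal_pdf_ge0.
- move=> x /=; rewrite in_itv/= => /andP[x1 _].
  by rewrite (le_trans x1)// ler_norm.
Qed.

End normal.

(** * Square-summable sequences and the test function *)

Section l2.
Context {R : realType}.
Implicit Types x y : nat -> R.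

(** The extended-real sum always exists, so in this form membership can be measured and
    integrated. *)
Lemma l2E x : l2 x <-> (\sum_(n <oo) (x n ^+ 2)%:E < +oo)%E.
Proof.
have nd : nondecreasing_seq (series (fun n => x n ^+ 2)).
  by apply: nondecreasing_series => n _ _; exact: sqr_ge0.
split=> [cx|].
  apply: (@le_lt_trans _ _ (limn (series (fun n => x n ^+ 2)))%:E); last exact: ltry.
  apply: lime_le; first by apply: is_cvg_nneseries => n _ _; rewrite lee_fin sqr_ge0.
  by apply: nearW => n; rewrite sumEFin lee_fin; exact: nondecreasing_cvgn_le.
move=> fx; apply: nondecreasing_is_cvgn => //.
have x0 : (0 <= \sum_(n <oo) (x n ^+ 2)%:E)%E.
  by apply: nneseries_ge0 => n _ _; rewrite lee_fin sqr_ge0.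
exists (fine (\sum_(n <oo) (x n ^+ 2)%:E)%E) => _ [n _ <-].
rewrite -lee_fin fineK ?ge0_fin_numE// -sumEFin.
by apply: nneseries_lim_ge => k _ _; rewrite lee_fin sqr_ge0.
Qed.

Lemma l2B x y : l2 x -> l2 y -> l2 (fun n => x n - y n).
Proof.
move=> cx cy.
(* Comparison through (a - b)^2 <= 2 (a^2 + b^2), which is (a + b)^2 >= 0. *)
apply: (@series_le_cvg _ _ ((2 : R) *: ((fun n => x n ^+ 2) + (fun n => y n ^+ 2)))).
- by move=> n; exact: sqr_ge0.
- by move=> n /=; rewrite mulr_ge0// addr_ge0 ?sqr_ge0.
- move=> n; rewrite !fctE /GRing.scale/=.
  by have := sqr_ge0 (x n + y n); lra.
- by apply: is_cvg_seriesZ; exact: is_cvg_seriesD.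
Qed.

Lemma norm_coord_le_l2norm x n : l2 x -> `|x n| <= l2norm x.
Proof.
move=> cx; rewrite -sqrtr_sqr; apply: ler_wsqrtr.
have nd : nondecreasing_seq (series (fun n => x n ^+ 2)).
  by apply: nondecreasing_series => k _ _; exact: sqr_ge0.
apply: le_trans (nondecreasing_cvgn_le nd cx n.+1).
rewrite seriesEnat/= big_nat_recr//= lerDr.
by apply: sumr_ge0 => k _; exact: sqr_ge0.
Qed.

(** The function is Lipschitz with constant [M]: a coordinate is dominated by the norm, and
    truncation at 1 does not increase distances. *)
Lemma coord_cutoff_Cb1 (M : R) n : 0 < M ->
  Cb1 (fun x => Num.min 1 (M * `|x n|)).
Proof.
move=> M0; split=> [x lx e e0|x lx]; last first.
  by rewrite ger0_norm ?ge_min ?lexx// le_min ler01 mulr_ge0// ltW.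
exists (e / M) => [|y ly xy]; first exact: divr_gt0.
have : M * `|x n - y n| < e.
  rewrite mulrC -ltr_pdivlMr//; apply: le_lt_trans xy.
  by apply: (norm_coord_le_l2norm (fun n => x n - y n) n); exact: l2B.
apply: le_lt_trans; have /= := ler_dist_dist (x n) (y n).
rewrite -(ler_pM2l M0) => /(le_trans _); apply.
rewrite (_ : M * `|_ - _| = `|M * `|x n| - M * `|y n| |); last first.
  by rewrite -mulrBr normrM (gtr0_norm M0).
move: (M * `|x n|) (M * `|y n|) => a b; rewrite ler_norml.
by case: (leP 1 a); case: (leP 1 b); case: (ler0P (a - b)) => *;
  apply/andP; split; lra.
Qed.

End l2.

(** * Diagonal Gaussian variables and the one-coordinate lower bound *)

Section gauss_diag.
Context {R : realType} {d} {O : measurableType d} (P : probability O R).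
Context (xi : nat -> O -> R).
Hypothesis xiP : iid_std_normal P xi.

Let mxi n : measurable_fun setT (xi n). Proof. by case: xiP. Qed.

Lemma ge0_integral_std_normal n (f : measurableTypeR R -> \bar R) :
  measurable_fun [set: measurableTypeR R] f -> (forall x, 0 <= f x)%E ->
  (\int[P]_w f (xi n w) = \int[normal_prob 0%R 1%R]_x f x)%E.
Proof.
move=> mf f0.
have mxiR : measurable_fun setT (xi n : O -> measurableTypeR R) by exact: mxi.
rewrite -(ge0_integral_pushforward mxiR P measurableT mf)//.
by apply: eq_measure_integral => A mA _; case: xiP => _ [+ _]; exact.
Qed.

Lemma measurable_gauss_diag_l2 (c : nat -> R) :
  measurable [set w | l2 (fun n => Num.sqrt (c n) * xi n w)].
Proof.
rewrite (_ : mkset _ = [set w | (\sum_(n <oo)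
    ((Num.sqrt (c n) * xi n w) ^+ 2)%:E < +oo)%E]); last first.
  by apply/seteqP; split=> w /= /l2E.
rewrite -[X in measurable X]setTI; apply: emeasurable_fun_infty_o => //.
apply: ge0_emeasurable_sum => [k w _ _|k _]; first by rewrite lee_fin sqr_ge0.
by apply/measurable_EFinP; apply: measurable_funX; exact: measurable_funM.
Qed.

Lemma measurable_gauss_diag (c : nat -> R) n :
  measurable_fun setT (fun w => gauss_diag xi c w n).
Proof.
have mE := measurable_gauss_diag_l2 c.
(* The default value 0 off the [l2] event amounts to multiplying by the indicator of that event. *)
rewrite (_ : (fun w => _) = (fun w => \1_[set w |
    l2 (fun n => Num.sqrt (c n) * xi n w)] w * (Num.sqrt (c n) * xi n w))).
  by apply: measurable_funM; [exact: measurable_indic|exact: measurable_funM].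
apply/funext => w; rewrite /gauss_diag indicE.
by case: asboolP => h; [rewrite mem_set ?mul1r|rewrite memNset ?mul0r].
Qed.

(* The expectation of [\sum_n c n * xi n ^ 2] is finite, so the series converges
   almost surely. *)
Lemma gauss_diag_ae (c : nat -> R) : (forall n, 0 <= c n) -> cvgn (series c) ->
  {ae P, forall w n, gauss_diag xi c w n = Num.sqrt (c n) * xi n w}.
Proof.
move=> c0 cc.
pose f w := (\sum_(n <oo) ((Num.sqrt (c n) * xi n w) ^+ 2)%:E)%E.
have mf1 n : measurable_fun setT (fun w => ((Num.sqrt (c n) * xi n w) ^+ 2)%:E).
  by apply/measurable_EFinP; apply: measurable_funX; exact: measurable_funM.
have f10 n w : (0 <= ((Num.sqrt (c n) * xi n w) ^+ 2)%:E)%E.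
  by rewrite lee_fin sqr_ge0.
have mf : measurable_fun setT f by exact: ge0_emeasurable_sum.
have intf : P.-integrable setT f.
  apply/integrableP; split=> //.
  under eq_integral do (rewrite gee0_abs; last by apply: nneseries_ge0).
  rewrite integral_nneseries//.
  have msq : measurable_fun [set: measurableTypeR R] (fun x : R => (x ^+ 2)%:E).
    by apply/measurable_EFinP; exact: measurable_funX.
  have sq0 (x : R) : (0 <= (x ^+ 2)%:E)%E by rewrite lee_fin sqr_ge0.
  rewrite (eq_eseriesr (g := fun n => ((c n)%:E *
      \int[normal_prob (0 : R) 1]_x (x ^+ 2)%:E)%E)); last first.
    move=> n _; under eq_integral do rewrite exprMn sqr_sqrtr// EFinM.
    rewrite ge0_integralZl//; last by rewrite lee_fin.
      by rewrite (ge0_integral_std_normal n _ msq).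
    by apply/measurable_EFinP; exact: measurable_funX.
  have := @normal_prob_sqr_lty R.
  have : (0 <= \int[normal_prob (0 : R) 1]_x (x ^+ 2)%:E)%E by exact: integral_ge0.
  case: (X in (0 <= X)%E -> (X < +oo)%E -> _) => // v v0 _.
  under eq_eseriesr do rewrite -EFinM.
  apply: (@le_lt_trans _ _ (v * limn (series c))%:E); last exact: ltry.
  apply: lime_le; first by apply: is_cvg_nneseries => n _ _; rewrite lee_fin mulr_ge0.
  apply: nearW => n; rewrite sumEFin lee_fin -mulr_suml mulrC; apply: ler_wpM2l => //.
  by apply: nondecreasing_cvgn_le => //; exact: nondecreasing_series.
have := integrable_ae measurableT intf; apply: filterS => w /(_ I) fw n.
rewrite /gauss_diag; case: asboolP => // - [].
by apply/l2E; rewrite -ge0_fin_numE//; exact: nneseries_ge0.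
Qed.

(** The expectation under [c1] is bounded below through the almost sure formula for the coordinate;
    the one under [c2] is bounded above pointwise, since the default value 0 only lowers the test
    function. *)
Lemma dist_Cb_ge (c1 c2 : nat -> R) n :
  (forall k, 0 <= c1 k) -> cvgn (series c1) -> 0 < c1 n ->
  ((normal_prob 0%R 1%R [set x : R | (1 <= `|x|)%R])
     - (Num.sqrt (c2 n / c1 n))%:E *
       (1 + \int[normal_prob 0%R 1%R]_x ((x : R) ^+ 2)%:E)
   <= dist_Cb P xi c1 c2)%E.
Proof.
move=> c10 cc1 c1n.
(* With this scale the cutoff under [c1] is almost surely min(1, |xi_n|), which dominates the
   indicator of |xi_n| >= 1. *)
set M := (Num.sqrt (c1 n))^-1; have M0 : 0 < M by rewrite invr_gt0 sqrtr_gt0.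
pose phi (x : nat -> R) := Num.min 1 (M * `|x n|).
have phi0 x : 0 <= phi x by rewrite le_min ler01 mulr_ge0// ltW.
have mphi c : measurable_fun setT (fun w => (phi (gauss_diag xi c w))%:E).
  apply/measurable_EFinP; apply: measurable_minr => //.
  apply: measurable_funM => //; apply: measurableT_comp => //.
  exact: measurable_gauss_diag.
have phi1 c : (gint P xi c phi <= 1)%E.
  rewrite -(probability_setT P) -(mul1e (P _)) -integral_cst//.
  apply: ge0_le_integral => //; first by move=> w _; rewrite lee_fin.
  by move=> w _; rewrite lee_fin ge_min lexx.
have gint0 c : (0 <= gint P xi c phi)%E.
  by apply: integral_ge0 => w _; rewrite lee_fin.
have mge1 : measurable [set x : measurableTypeR R | (1 <= `|x|)%R].
  rewrite -[X in measurable X]setTI.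
  by apply: measurable_fun_le => //; exact: measurableT_comp.
have mxige1 : measurable [set w | 1 <= `|xi n w|].
  rewrite -[X in measurable X]setTI.
  by apply: measurable_fun_le => //; exact: measurableT_comp.
have lo : (normal_prob 0%R 1%R [set x : R | (1 <= `|x|)%R] <= gint P xi c1 phi)%E.
  have -> : normal_prob 0%R 1%R [set x : R | (1 <= `|x|)%R] =
      P [set w | 1 <= `|xi n w|] by case: xiP => _ [/(_ n _ mge1)].
  rewrite -[X in P X]setIT -integral_indic//.
  apply: ae_ge0_le_integral => //.
  - by apply/measurable_EFinP; exact: measurable_indic.
  - by move=> w _; rewrite lee_fin.
  - have := gauss_diag_ae c1 c10 cc1; apply: filterS => w /(_ n) E _.
    rewrite lee_fin /phi E normrM ger0_norm ?sqrtr_ge0// mulKf ?gt_eqF ?sqrtr_gt0//.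
    rewrite indicE le_min; case: (boolP (_ \in _)) => [|_]/=.
      by rewrite inE/= => ->; rewrite lexx.
    by rewrite ler01 normr_ge0.
have up : (gint P xi c2 phi <= (Num.sqrt (c2 n / c1 n))%:E *
       (1 + \int[normal_prob 0%R 1%R]_x ((x : R) ^+ 2)%:E))%E.
  have msq : measurable_fun [set: measurableTypeR R] (fun x : R => (x ^+ 2)%:E).
    by apply/measurable_EFinP; exact: measurable_funX.
  have msqxi : measurable_fun setT (fun w => (xi n w ^+ 2)%:E).
    by apply/measurable_EFinP; exact: measurable_funX.
  have sq0 (x : R) : (0 <= (x ^+ 2)%:E)%E by rewrite lee_fin sqr_ge0.
  rewrite -(ge0_integral_std_normal n _ msq)//.
  rewrite -[X in (_ * (X + _))%E](probability_setT P) -(mul1e (P _)) -integral_cst//.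
  rewrite -ge0_integralD//.
  rewrite -ge0_integralZl//; first last.
  - by move=> w _; rewrite adde_ge0.
  - exact: emeasurable_funD.
  apply: ge0_le_integral => //.
  - by move=> w _; rewrite lee_fin.
  - by apply: emeasurable_funM => //; exact: emeasurable_funD.
  - move=> w _; rewrite -EFinD -EFinM lee_fin /phi ge_min; apply/orP; right.
    apply: (@le_trans _ _ (Num.sqrt (c2 n / c1 n) * `|xi n w|)); last first.
      apply: ler_wpM2l; first exact: sqrtr_ge0.
      (* This is |t| <= 1 + t^2, which replaces a first moment by the second. *)
      by case: (ger0P (xi n w)) => ?; nra.
    rewrite /gauss_diag; case: asboolP => _; last first.
      by rewrite normr0 mulr0 mulr_ge0 ?sqrtr_ge0.
    rewrite normrM (ger0_norm (sqrtr_ge0 _)) mulrA; apply: ler_wpM2r => //.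
    (* For negative [c2 n] the coordinate vanishes, as [Num.sqrt] is 0 there. *)
    have [c20|c20] := leP 0 (c2 n).
      by rewrite sqrtrM// sqrtrV ?(ltW c1n)// mulrC.
    by rewrite (ltr0_sqrtr c20) mulr0 sqrtr_ge0.
apply: le_ereal_sup_tmp; exists `|gint P xi c1 phi - gint P xi c2 phi|%E.
  by exists phi => //; exact: coord_cutoff_Cb1.
apply: le_trans (lee_abs _).
exact: leeB.
Qed.

End gauss_diag.

(** * Bounds on the exact and Euler covariances *)

Section covariances.
Context {R : realType}.

Lemma lam_ge (n : nat) : n.+1%:R <= lam R n.
Proof.
have pi1 : 1 <= pi :> R by have := pi_ge2 R; lra.
have n1 : (1 : R) <= n.+1%:R by rewrite ler1n.
rewrite /lam; have : 1 <= pi ^+ 2 :> R by rewrite exprn_ege1.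
by move: (pi ^+ 2) => p p1; nra.
Qed.

Lemma lam_gt0 n : 0 < lam R n.
Proof. by rewrite (lt_le_trans _ (lam_ge n)). Qed.

(* Rewriting with [mulr_gt0] would unfold [lam] and split its product. *)
Lemma lam2_gt0 n : 0 < 2 * lam R n.
Proof. by have := lam_gt0 n; lra. Qed.

(** Since [lam] is increasing, the numerator is smallest at index 0; this gives a lower bound of
    order 1 / lam_n with a constant independent of [n]. *)
Lemma cov_exact_ge (T : R) n : 0 < T ->
  (1 - expR (- (2 * lam R 0 * T))) / (2 * lam R n) <= cov_exact T n.
Proof.
move=> T0; apply: ler_wpM2r; first by rewrite invr_ge0 ltW// lam2_gt0.
rewrite lerD2l lerN2 ler_expR lerN2; apply: ler_wpM2r; first exact: ltW.
apply: ler_wpM2l => //; rewrite /lam; apply: ler_wpM2l; first exact: sqr_ge0.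
by rewrite lerXn2r ?nnegrE// ler_nat.
Qed.

Lemma cov_exact_gap (T : R) : 0 < T -> 0 < 1 - expR (- (2 * lam R 0 * T)).
Proof.
move=> T0; rewrite subr_gt0 -[ltRHS]expR0 ltr_expR oppr_lt0.
exact: mulr_gt0 (lam2_gt0 0) T0.
Qed.

Lemma cov_exact_gt0 (T : R) n : 0 < T -> 0 < cov_exact T n.
Proof.
move=> T0; apply: lt_le_trans (cov_exact_ge T n T0).
exact: divr_gt0 (cov_exact_gap T T0) (lam2_gt0 n).
Qed.

(** Comparison with a telescoping series: for a = n + 1, the term is at most 1 / (2 a^2) <= 1 / (a
    (a + 1)). *)
Lemma cov_exact_cvg (T : R) : 0 < T -> cvgn (series (cov_exact T)).
Proof.
move=> T0; pose v := fun n : nat => (n.+1%:R : R)^-1 - n.+2%:R^-1.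
apply: (@series_le_cvg _ _ v) => [n|n|n|].
- by rewrite ltW// cov_exact_gt0.
- by rewrite subr_ge0 lef_pV2 ?posrE// ler_nat.
- have n1 : (1 : R) <= n.+1%:R by rewrite ler1n.
  have n2 : n.+2%:R = n.+1%:R + 1 :> R by rewrite -natr1.
  have l0 : (n.+1%:R ^+ 2) <= lam R n.
    rewrite /lam ler_peMl ?sqr_ge0//; have := pi_ge2 R => p2.
    by rewrite exprn_ege1//; lra.
  apply: (@le_trans _ _ (1 / (2 * n.+1%:R ^+ 2))).
    apply: ler_pM; rewrite ?invr_ge0 ?(ltW (lam2_gt0 n))//.
    - rewrite subr_ge0 -[leRHS]expR0 ler_expR oppr_le0.
      exact: ltW (mulr_gt0 (lam2_gt0 n) T0).
    - by rewrite lef_pV2 ?posrE ?lam2_gt0// ler_pM2l.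
  rewrite /v n2; move: (n.+1%:R : R) n1 => a a1.
  rewrite (_ : a^-1 - (a + 1)^-1 = (a * (a + 1))^-1); last first.
    by field; rewrite !gt_eqF//; lra.
  rewrite div1r lef_pV2 ?posrE ?mulr_gt0 ?exprn_gt0//; [nra|lra..].
- have -> : series v = (fun n => 1 - (n.+1%:R)^-1).
    apply/funext => n; rewrite seriesEnat/= /v.
    elim: n => [|n IH]; first by rewrite big_geq// invr1 subrr.
    by rewrite big_nat_recr//= IH subrKA.
  by apply: is_cvgB; [exact: is_cvg_cst|apply/cvg_ex; exists 0; exact: cvg_harmonic].
Qed.

(** With q = 1 + dt lam_n, the covariance satisfies C_(k+1) = (C_k + dt) / q^2. The bound B = 1 /
    (dt lam_n^2) is preserved because B (q^2 - 1) = 2 / lam_n + dt >= dt. *)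
Lemma cov_euler_le (dt : R) k n : 0 < dt ->
  cov_euler dt k n <= (dt * lam R n ^+ 2)^-1.
Proof.
move=> dt0; rewrite /cov_euler; have := lam_gt0 n; move: (lam R n) => l l0.
have q0 : 0 < 1 + dt * l by rewrite addr_gt0// mulr_gt0.
elim: k => [|k IH].
  by rewrite big_geq// mulr0 invr_ge0 mulr_ge0 ?sqr_ge0// ltW.
rewrite big_nat_recr//= subSnn muln1.
rewrite (eq_big_nat _ _ (F2 := fun i => (1 + dt * l) ^- (2 * (k - i)) *
    (1 + dt * l) ^- 2)); last first.
  by move=> i /andP[_ ik]; rewrite subSn ?(ltnW ik)// mulnS addnC exprD invfM.
rewrite -mulr_suml mulrDr mulrA -mulrDl ler_pdivrMr ?exprn_gt0//.
apply: (le_trans (lerD IH (lexx dt))).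
rewrite -lerBrDl -[X in _ <= _ - X]mulr1 -mulrBr mulrC.
rewrite ler_pdivlMr ?mulr_gt0 ?exprn_gt0//.
have := mulr_gt0 dt0 l0; lra.
Qed.

Lemma cov_ratio_small (T dt e : R) : 0 < T -> 0 < dt -> 0 < e ->
  exists n, forall k, cov_euler dt k n / cov_exact T n <= e.
Proof.
move=> T0 dt0 e0; set a := 1 - expR (- (2 * lam R 0 * T)).
have a0 : 0 < a := cov_exact_gap T T0.
have b0 : 0 < dt * a * e by rewrite !mulr_gt0.
(* By [lam_ge] this index gives lam_n >= 2 / (dt a e), which is exactly 1 / (dt lam_n^2) <= e a / (2
   lam_n). It is chosen before the number of steps [k]. *)
exists (truncn (2 / (dt * a * e))) => k; set n := truncn _.
have ln : 2 / (dt * a * e) <= lam R n.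
  by apply: le_trans (lam_ge n); rewrite ltW// truncnS_gt.
have l0 := lam_gt0 n.
rewrite ler_pdivrMr ?cov_exact_gt0//.
apply: (le_trans (cov_euler_le dt k n dt0)).
apply: le_trans (_ : e * (a / (2 * lam R n)) <= _); last first.
  by apply: ler_wpM2l; [exact: ltW|exact: cov_exact_ge].
move: ln; rewrite ler_pdivrMr// => ln.
rewrite (mulrA e) (ler_pdivlMr _ _ (lam2_gt0 n)).
rewrite ler_pdivrMl; last by rewrite mulr_gt0// exprn_gt0.
move: (lam R n) l0 ln => l l0 ln; nra.
Qed.

End covariances.

(** * Passage to the limit superior for both schemes *)

Lemma limf_esup_ge_near {T : choiceType} {X : filteredType T} {R : realType}
    (F : set_system X) {FF : ProperFilter F} (f : X -> \bar R) (e : \bar R) :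
  (\forall x \near F, (e <= f x)%E) -> (e <= limf_esup f F)%E.
Proof.
(* Every [V] in the filter meets the set where [e <= f x], so each supremum in the infimum is at
   least [e]. *)
move=> ef; apply: le_ereal_inf_tmp => _ [V FV <-].
have [x [ex Vx]] := filter_ex (filterI ef FV).
by apply: le_ereal_sup_tmp; exists (f x) => //; exists x.
Qed.

Theorem theorem3p1 (R : realType) (d : measure_display) (O : measurableType d)
  (P : probability O R) (xi : nat -> O -> R) (T : R) :
  iid_std_normal P xi -> 0 < T ->
  (0 < limn_esup (fun N : nat => dist_Cb P xi (cov_exact T) (cov_galerkin N T)))%E /\
  (0 < limf_esup (fun dt : R => dist_Cb P xi (cov_exact T)
                    (cov_euler dt (truncn (T / dt)))) 0^'+)%E.
Proof.
move=> xiP T0.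
have c0 n : 0 <= cov_exact T n by rewrite ltW// cov_exact_gt0.
have ge n c := dist_Cb_ge P xi xiP _ c n c0 (cov_exact_cvg T T0) (cov_exact_gt0 T n T0).
move: ge (@normal_prob_norm_ge1_gt0 R) (@normal_prob_sqr_lty R).
have : (0 <= \int[normal_prob (0 : R) 1]_x (x ^+ 2)%:E)%E.
  by apply: integral_ge0 => x _; rewrite lee_fin sqr_ge0.
(* The sign and the finiteness of the second moment leave only a real value [v]; the probability
   becomes a real [p] in the same way. *)
case: (\int[_]_x _)%E => // v v0.
have : (normal_prob (0 : R) 1 [set x : R | (1 <= `|x|)%R] <= 1)%E.
  apply: probability_le1.
  rewrite -[X in measurable X]setTI.
  by apply: measurable_fun_le => //; exact: measurableT_comp.
case: (normal_prob _ _ _) => [p|//|] // _ ge p0 _.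
rewrite lee_fin in v0; rewrite lte_fin in p0.
split.
  apply: (@lt_le_trans _ _ p%:E); first by rewrite lte_fin.
  apply: limf_esup_ge_near; apply: nearW => N.
  (* With indices from 0, coordinate [N] is the first one killed by the projection, so the whole gap
     [p] remains. *)
  have := ge N (cov_galerkin N T).
  by rewrite /cov_galerkin ltnn mul0r sqrtr0 mul0e sube0.
apply: (@lt_le_trans _ _ (p / 2)%:E); first by rewrite lte_fin divr_gt0.
apply: limf_esup_ge_near; near=> dt.
have dt0 : 0 < dt by near: dt; exact: nbhs_right_gt.
(* Chosen so that e (1 + v) = p / 2, half of the gap. The covariance ratio stands under a square
   root, hence the bound [e ^+ 2] on it. *)
pose e := p / 2 / (1 + v).
have e0 : 0 < e by rewrite !divr_gt0 ?ltr_pwDl//.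
have [n ne] := cov_ratio_small T dt (e ^+ 2) T0 dt0 (exprn_gt0 2 e0).
apply: le_trans (ge n _); rewrite -(EFinD 1 v) -EFinM -EFinB lee_fin.
rewrite lerBrDr -lerBrDl.
apply: (@le_trans _ _ (e * (1 + v))).
  apply: ler_wpM2r; first by rewrite addr_ge0.
  by rewrite -[leRHS](ger0_norm (ltW e0)) -sqrtr_sqr ler_wsqrtr.
by rewrite /e divfK ?gt_eqF ?ltr_pwDl//; lra.
Unshelve. all: by end_near. Qed.
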